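(* For the periodic quantum graph associated with the triangular tiling with edge length $a$ and potentials $q_1,q_2,q_3$ on its three classes of edges, the characteristic function is $$\Phi(\rho)=-e^{-2i\theta_2}\left\{(S_1S_2S_3)'+(CSS)_{123}-2S_1S_2\cos(\theta_2-\theta_1)-2S_2S_3\cos\theta_1-2S_1S_3\cos\theta_2\right\},$$ where $(S_1S_2S_3)'=S_1'S_2S_3+S_1S_2'S_3+S_1S_2S_3'$ and $(CSS)_{123}=C_1S_2S_3+C_2S_3S_1+C_3S_1S_2$.
   Context: Let $a>0$, $q_1,q_2,q_3\in L^2(0,a)$ real-valued (not assumed identical or even), $\rho\in\mathbb C$, $\lambda=\rho^2$. Let $C_j(x,\rho),S_j(x,\rho)$ be the solutions of $-y''+q_jy=\rho^2y$ on $[0,a]$ with $C_j(0,\rho)=S_j'(0,\rho)=1$, $C_j'(0,\rho)=S_j(0,\rho)=0$; abbreviate $C_j=C_j(a,\rho)$, $C_j'=C_j'(a,\rho)$, $S_j=S_j(a,\rho)$, $S_j'=S_j'(a,\rho)$. The graph of the triangular tiling is periodic with respect to $\vec k_1=(\frac a2,\frac{\sqrt3}2a)$, $\vec k_2=(a,0)$; modulo translations it has one vertex $v$ and edges $e_1:v\to v+\vec k_1$, $e_2:v\to v+\vec k_2$, $e_3:v\to v+\vec k_2-\vec k_1$, each parametrized by $[0,a]$ in the indicated direction and carrying potential $q_j$. For a quasi-momentum $\Theta=(\theta_1,\theta_2)\in[-\pi,\pi]^2$, the Bloch Hamiltonian $H^\Theta$ acts as $-y''+q_jy$ on edges, on functions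 satisfying the continuity–Kirchhoff condition at vertices and $y(x+p_1\vec k_1+p_2\vec k_2)=e^{i(p_1\theta_1+p_2\theta_2)}y(x)$, $p_1,p_2\in\mathbb Z$. Writing $y_j=A_jC_j(x,\rho)+B_jS_j(x,\rho)$ on $e_j$, and $\alpha=e^{-i\theta_1}$, $\beta=e^{-i\theta_2}$, the vertex and Floquet–Bloch conditions become a homogeneous linear system in the unknowns ordered $(A_1,A_2,A_3,B_1,B_2,B_3)$. The characteristic function $\Phi(\rho)$ is the determinant of the $6\times6$ matrix whose rows are, in order, the coefficients of the linear forms 1. $-A_1+A_2$ 2. $-A_1+A_3$ 3. $(-1+\alpha C_1)A_1+\alpha S_1B_1$ 4. $-A_1+\beta C_2A_2+\beta S_2B_2$ 5. $-A_1+\alpha^{-1}\beta C_3A_3+\alpha^{-1}\beta S_3B_3$ 6. $\alpha C_1'A_1+\beta C_2'A_2+\alpha^{-1}\beta C_3'A_3+(-1+\alpha S_1')B_1+(-1+\beta S_2')B_2+(-1+\alpha^{-1}\beta S_3')B_3$. Thus $\rho^2\in\sigma(H^\Theta)$ if and only if $\Phi(\rho)=0$. *)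

(* Defs.v *)
From mathcomp Require Import all_boot all_order all_algebra.
From mathcomp Require Import all_classical all_reals all_analysis.
From mathcomp Require Import complex.

Set Implicit Arguments.
Unset Strict Implicit.
Unset Printing Implicit Defensive.

Import Order.TTheory GRing.Theory Num.Theory.
Import numFieldNormedType.Exports.

Local Open Scope classical_set_scope.
Local Open Scope ring_scope.
Local Open Scope complex_scope.

(* [f] has derivative [l] at [x] relative to [D]; at an endpoint of an interval
   [D] this is the one-sided derivative. *)
Definition has_deriv_within (R : realType) (D : set R) (f : R -> R[i]) (x : R)
    (l : R[i]) : Prop :=
  (((f z - f x) / (z - x)%:C : R[i]^o) @[z --> within D x^'] --> (l : R[i]^o)).

Definition abs_continuous (R : realType) (a b : R) (f : R -> R[i]) : Prop :=
  forall eps : R, 0 < eps -> exists2 delta : R, 0 < delta &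
    forall (n : nat) (u v : 'I_n -> R),
      (forall k, a <= u k <= v k /\ v k <= b) ->
      trivIset [set: 'I_n] (fun k => `]u k, v k[%classic) ->
      \sum_k (v k - u k) < delta ->
      \sum_k `|f (v k) - f (u k)| < eps%:C.

(* [L^2(0,a)], a function being extended by zero outside [(0,a)] *)
Definition L2_on (R : realType) (a : R) (q : R -> R) : Prop :=
  (q \_ `]0, a[) \in Lfun (@lebesgue_measure R) 2%:E.

(* [y] is a solution of [-y'' + q y = rho^2 y] on [[0,a]] with [y' = dy].
   As [q] is only square-integrable this is meant in the Caratheodory sense:
   [y] and [y'] are absolutely continuous (that of [y] follows from [y'] being
   continuous on [[0,a]]) and the equation holds almost everywhere. *)
Definition is_solution (R : realType) (a : R) (q : R -> R) (rho : R[i])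
    (y dy : R -> R[i]) : Prop :=
  [/\ forall x, x \in `[0, a] -> has_deriv_within `[0, a] y x (dy x),
      abs_continuous 0 a dy
    & {ae @lebesgue_measure R, forall x, x \in `]0, a[ ->
        exists2 ddy : R[i], has_deriv_within `[0, a] dy x ddy
          & - ddy + (q x)%:C * y x = rho ^+ 2 * y x}].

Definition fundamental_pair (R : realType) (a : R) (q : R -> R) (rho : R[i])
    (C dC S dS : R -> R[i]) : Prop :=
  [/\ is_solution a q rho C dC, is_solution a q rho S dS,
      C 0 = 1 /\ dC 0 = 0 & S 0 = 0 /\ dS 0 = 1].

(* [exp (i t)] *)
Definition expi (R : realType) (t : R) : R[i] := cos t +i* sin t.

(* The matrix of the vertex and Floquet-Bloch conditions in the unknowns
   [(A_1, A_2, A_3, B_1, B_2, B_3)]; [Cj], [dCj], [Sj], [dSj] are the values at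
   [a] of the fundamental solutions on the edge [e_j] and of their
   derivatives. *)
Definition char_matrix (R : realType) (theta1 theta2 : R)
    (C1 C2 C3 dC1 dC2 dC3 S1 S2 S3 dS1 dS2 dS3 : R[i]) : 'M[R[i]]_6 :=
  let alpha := expi (- theta1) in
  let beta := expi (- theta2) in
  let rows :=
    [:: [:: -1; 1; 0; 0; 0; 0];
        [:: -1; 0; 1; 0; 0; 0];
        [:: -1 + alpha * C1; 0; 0; alpha * S1; 0; 0];
        [:: -1; beta * C2; 0; 0; beta * S2; 0];
        [:: -1; 0; alpha^-1 * beta * C3; 0; 0; alpha^-1 * beta * S3];
        [:: alpha * dC1; beta * dC2; alpha^-1 * beta * dC3;
            -1 + alpha * dS1; -1 + beta * dS2; -1 + alpha^-1 * beta * dS3]] in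
  \matrix_(i < 6, j < 6) nth 0 (nth [::] rows i) j.

Definition char_function (R : realType) (a theta1 theta2 : R)
    (C1 C2 C3 dC1 dC2 dC3 S1 S2 S3 dS1 dS2 dS3 : R -> R[i]) : R[i] :=
  \det (char_matrix theta1 theta2 (C1 a) (C2 a) (C3 a) (dC1 a) (dC2 a) (dC3 a)
         (S1 a) (S2 a) (S3 a) (dS1 a) (dS2 a) (dS3 a)).

(* Main.v *)
(* Setting A_1 = A_2 = A_3, the determinant is the sum over the edges of
   (x_j C_j - 1)(x_j S_j' - 1) - x_j^2 C_j' S_j times the x_k S_k of the two
   other edges, where x_1, x_2, x_3 = alpha, beta, beta / alpha.  The Wronskian
   relation C_j S_j' - C_j' S_j = 1 turns this factor into
   x_j (x_j + 1 / x_j - C_j - S_j'), and x_j + 1 / x_j is twice a cosine.  As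
   the potentials are only square-integrable, the Wronskian is merely absolutely
   continuous with derivative zero almost everywhere; that such a function is
   constant is proved by a covering argument. *)

Require Import Defs.
From mathcomp Require Import all_boot all_order all_algebra.
From mathcomp Require Import all_classical all_reals all_analysis.
From mathcomp Require Import complex ring lra.

Set Implicit Arguments.
Unset Strict Implicit.
Unset Printing Implicit Defensive.

Import Order.TTheory GRing.Theory Num.Theory.
Import numFieldNormedType.Exports.

Local Open Scope classical_set_scope.
Local Open Scope ring_scope.
Local Open Scope complex_scope.

Import ComplexField.Normc.

(** * Real-valued modulus and induction along an interval *)

Lemma normc_normE (R : rcfType) (z : R[i]) : `|z| = (normc z)%:C.
Proof. by rewrite normc_def; case: z. Qed.

Lemma normc_ge0 (R : rcfType) (z : R[i]) : 0 <= normc z.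
Proof. by rewrite -lecR -normc_normE normr_ge0. Qed.

Lemma normc_real (R : rcfType) (x : R) : normc x%:C = `|x|.
Proof. by rewrite /normc /= expr0n addr0 sqrtr_sqr. Qed.

(* Real induction; it replaces Cousin's lemma on the existence of partitions
   finer than a given gauge. *)
Lemma interval_induction (R : realType) (a b : R) (P : R -> Prop) :
  a <= b -> P a ->
  (forall x, a <= x <= b -> exists2 delta : R, 0 < delta &
     forall t v, a <= t <= x -> x <= v <= b -> x - delta < t ->
       v < x + delta -> P t -> P v) ->
  P b.
Proof.
move=> ab Pa step.
pose A : set R := [set t | a <= t <= b /\ P t].
have Aa : A a by split; rewrite ?lexx.
have Aub : ubound A b by move=> t [/andP[]].
have supA : has_sup A by split; [exists a | exists b].
have as_ : a <= sup A by apply: sup_upper_bound.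
have sb : sup A <= b by apply: ge_sup => //; exists a.
have [|d d0 Hd] := step (sup A); first by rewrite as_ sb.
have [t At st] := sup_adherent d0 supA.
have ts : t <= sup A by apply: sup_upper_bound.
case: At => /andP[at_ tb] Pt.
(* Either [b] is within reach of [t], or [P] propagates to [sup A + d / 2], beyond the supremum. *)
have [bs|sb'] := ltP b (sup A + d).
  by apply: (Hd t b) => //; rewrite ?at_ ?ts ?sb ?lexx.
have Pv : P (sup A + d / 2).
  by apply: (Hd t) => //; rewrite ?at_ ?ts//; lra.
have : sup A + d / 2 <= sup A.
  by apply: sup_upper_bound => //; split => //; lra.
lra.
Qed.

(** * Absolutely continuous functions *)

Lemma abs_continuousP (R : realType) (a b : R) (f : R -> R[i]) :
  abs_continuous a b f <->
  forall eps : R, 0 < eps -> exists2 delta : R, 0 < delta &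
    forall (n : nat) (u v : 'I_n -> R),
      (forall k, a <= u k <= v k /\ v k <= b) ->
      trivIset [set: 'I_n] (fun k => `]u k, v k[%classic) ->
      \sum_k (v k - u k) < delta ->
      \sum_k normc (f (v k) - f (u k)) < eps.
Proof.
have E n (u v : 'I_n -> R) : \sum_k `|f (v k) - f (u k)| =
    (\sum_k normc (f (v k) - f (u k)))%:C.
  by rewrite rmorph_sum; apply: eq_bigr => k _; rewrite normc_normE.
split=> fac eps /fac[d d0 Hd]; exists d => // n u v uv duv suv.
- by rewrite -ltcR -E; exact: Hd.
- by rewrite E ltcR; exact: Hd.
Qed.

Lemma abs_continuous_modulus (R : realType) (a b : R) (f : R -> R[i]) :
  abs_continuous a b f ->
  forall eps : R, 0 < eps -> exists2 delta : R, 0 < delta &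
    forall u v, a <= u -> u <= v -> v <= b -> v - u < delta ->
      normc (f v - f u) < eps.
Proof.
move=> /abs_continuousP fac eps /fac[d d0 Hd]; exists d => // u v au uv vb vud.
have /= := Hd 1%N (fun=> u) (fun=> v); rewrite !big_ord1; apply => //.
- by move=> _; rewrite au uv.
- by apply/trivIsetP => i j _ _; rewrite !ord1 eqxx.
Qed.

(** Real induction on boundedness over [[a, t]]: over a short enough step [f] moves by less than 1,
    so the bound grows by at most 1. *)
Lemma abs_continuous_bounded (R : realType) (a b : R) (f : R -> R[i]) :
  abs_continuous a b f ->
  exists2 M : R, 0 <= M & forall x, a <= x <= b -> normc (f x) <= M.
Proof.
move=> fac; have [ab|ba] := leP a b; last first.
  by exists 0 => // x /andP[ax xb]; have := le_trans ax xb; rewrite leNgt ba.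
have [d d0 Hd] := abs_continuous_modulus fac ltr01.
apply: (@interval_induction R a b
  (fun t => exists2 M : R, 0 <= M & forall x, a <= x <= t -> normc (f x) <= M)) => //.
  exists (normc (f a)); first exact: normc_ge0.
  by move=> x /andP[ax xa]; rewrite (le_anti (introT andP (conj ax xa))).
move=> x _; exists (d / 2); first lra.
move=> t v /andP[at_ tx] /andP[xv vb] xt vx [M M0 HM].
exists (M + 1); first lra.
move=> y /andP[ay yv]; have [yt|ty] := leP y t.
  by apply: (le_trans (HM y _)); [rewrite ay|lra].
rewrite -[f y](subrK (f t)) addrC; apply: (le_trans (le_normcD _ _)).
apply: lerD; first by apply: HM; rewrite at_ lexx.
by apply/ltW/Hd => //; lra.
Qed.

Lemma abs_continuousB (R : realType) (a b : R) (f g : R -> R[i]) :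
  abs_continuous a b f -> abs_continuous a b g ->
  abs_continuous a b (fun x => f x - g x).
Proof.
move=> /abs_continuousP fac /abs_continuousP gac; apply/abs_continuousP.
move=> eps eps0; have e2 : 0 < eps / 2 by lra.
have [d1 d10 H1] := fac _ e2; have [d2 d20 H2] := gac _ e2.
exists (Num.min d1 d2); first by rewrite lt_min d10.
move=> n u v uv duv; rewrite lt_min => /andP[s1 s2].
have := ltrD (H1 n u v uv duv s1) (H2 n u v uv duv s2).
rewrite -big_split /= -splitr; apply: le_lt_trans; apply: ler_sum => k _.
rewrite -(normcN (g _ - _)); apply: le_trans (le_normcD _ _).
by rewrite le_eqVlt; apply/orP; left; apply/eqP; congr normc; ring.
Qed.

Lemma abs_continuousM (R : realType) (a b : R) (f g : R -> R[i]) :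
  abs_continuous a b f -> abs_continuous a b g ->
  abs_continuous a b (fun x => f x * g x).
Proof.
move=> fac gac; have [M M0 fM] := abs_continuous_bounded fac.
have [L L0 gL] := abs_continuous_bounded gac.
move/abs_continuousP: fac => fac; move/abs_continuousP: gac => gac.
apply/abs_continuousP => eps eps0.
(* The increments of each factor get multiplied by the bound of the other one; adding 1 keeps the
   denominators positive when a bound is 0. *)
have e1 : 0 < eps / (2 * (L + 1)) by rewrite divr_gt0//; lra.
have e2 : 0 < eps / (2 * (M + 1)) by rewrite divr_gt0//; lra.
have [d1 d10 H1] := fac _ e1; have [d2 d20 H2] := gac _ e2.
exists (Num.min d1 d2); first by rewrite lt_min d10.
move=> n u v uv duv; rewrite lt_min => /andP[s1 s2].
have := H1 n u v uv duv s1; have := H2 n u v uv duv s2.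
rewrite !ltr_pdivlMr; [|lra|lra].
set s := \sum_k normc (g _ - _); set r := \sum_k normc (f _ - _) => sM rL.
have s0 : 0 <= s by apply: sumr_ge0 => k _; exact: normc_ge0.
have r0 : 0 <= r by apply: sumr_ge0 => k _; exact: normc_ge0.
apply: (@le_lt_trans _ _ (M * s + L * r)); last by nra.
rewrite !mulr_sumr -big_split; apply: ler_sum => k _ /=.
have [/andP[au uv'] vb] := uv k.
have -> : f (v k) * g (v k) - f (u k) * g (u k) =
  f (v k) * (g (v k) - g (u k)) + g (u k) * (f (v k) - f (u k)) by ring.
apply: (le_trans (le_normcD _ _)); rewrite !normcM.
apply: lerD; apply: ler_wpM2r; rewrite ?normc_ge0//.
- by apply: fM; rewrite vb (le_trans au).
- by apply: gL; rewrite au (le_trans uv').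
Qed.

Lemma lipschitz_abs_continuous (R : realType) (a b M : R) (f : R -> R[i]) :
  (forall u v, a <= u -> u <= v -> v <= b ->
    normc (f v - f u) <= M * (v - u)) ->
  abs_continuous a b f.
Proof.
move=> fL; apply/abs_continuousP => eps eps0.
(* [M] may have any sign; [|M| + 1] is positive and dominates it. *)
have M0 : 0 < `|M| + 1 by rewrite ltr_wpDl.
exists (eps / (`|M| + 1)); first exact: divr_gt0.
move=> n u v uv _; rewrite ltr_pdivlMr// mulrC; apply: le_lt_trans.
rewrite mulr_sumr; apply: ler_sum => k _; have [/andP[au uv'] vb] := uv k.
apply: (le_trans (fL _ _ au uv' vb)); apply: ler_wpM2r; first by rewrite subr_ge0.
by rewrite (le_trans (ler_norm M))// lerDl.
Qed.

(** * Derivatives relative to a set *)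

Lemma has_deriv_withinP (R : realType) (D : set R) (f : R -> R[i]) x l :
  has_deriv_within D f x l ->
  forall eps : R, 0 < eps -> exists2 delta : R, 0 < delta &
    forall z, D z -> `|z - x| < delta ->
      normc (f z - f x - l * (z - x)%:C) <= eps * `|z - x|.
Proof.
move=> /cvgrPdist_le fl eps eps0; have /fl : 0 < eps%:C by rewrite ltcR.
rewrite /within /= => -[d /= d0 Hd]; exists d => // z Dz zx.
have [->|zNx] := eqVneq z x.
  by rewrite !subrr mulr0 subrr normr0 mulr0 normc0.
have z0 : (z - x)%:C != 0 by rewrite fmorph_eq0 subr_eq0.
have := Hd z; rewrite /ball_ /= distrC => /(_ zx zNx Dz).
rewrite normc_normE lecR => H.
have -> : f z - f x - l * (z - x)%:C =
    - ((l - (f z - f x) / (z - x)%:C) * (z - x)%:C).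
  by rewrite mulrBl divfK// opprB.
by rewrite normcN normcM normc_real ler_wpM2r.
Qed.

Lemma has_deriv_withinB (R : realType) (D : set R) (f g : R -> R[i]) x l m :
  has_deriv_within D f x l -> has_deriv_within D g x m ->
  has_deriv_within D (fun z => f z - g z) x (l - m).
Proof.
move=> fl gm; apply: cvg_trans (cvgB fl gm); apply: near_eq_cvg; apply: nearW => z /=.
by rewrite !fctE /= -mulrBl; congr (_ / _); ring.
Qed.

(** The limit behind the product rule: [df] and [dg] stand for the difference quotients, [d] for the
    increment of the argument. The last hypothesis makes [g] tend to [g0]. *)
Lemma cvg_product_increment (K : numFieldType) (T : Type) (F : set_system T)
    {FF : Filter F} (df dg d g : T -> K) (f0 g0 l m : K) :
  df z @[z --> F] --> l -> dg z @[z --> F] --> m -> d z @[z --> F] --> (0 : K) ->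
  (\forall z \near F, g z = g0 + dg z * d z) ->
  df z * g z + f0 * dg z @[z --> F] --> l * g0 + f0 * m.
Proof.
move=> dfl dgm d0 gE.
have gg0 : g z @[z --> F] --> g0.
  have H : g0 + dg z * d z @[z --> F] --> g0 + m * 0.
    by apply: cvgD; [exact: cvg_cst | exact: cvgM].
  rewrite mulr0 addr0 in H; apply: cvg_trans H; apply: near_eq_cvg.
  by apply: filterS gE => z ->.
by apply: cvgD; apply: cvgM => //; exact: cvg_cst.
Qed.

Lemma has_deriv_withinM (R : realType) (D : set R) (f g : R -> R[i]) x l m :
  has_deriv_within D f x l -> has_deriv_within D g x m ->
  has_deriv_within D (fun z => f z * g z) x (l * g x + f x * m).
Proof.
move=> fl gm.
have idx : ((z - x)%:C : R[i]^o) @[z --> within D x^'] --> (0 : R[i]^o).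
  (* A positive element of [R[i]] is real, so its real part serves as radius. *)
  apply/cvgrPdist_le => e; rewrite ltcE => /andP[/eqP Ime e0].
  exists (complex.Re e) => //= z; rewrite /ball_ /= => zx _ _.
  rewrite sub0r normrN normc_normE normc_real distrC.
  by rewrite (complexE e) Ime /= mulr0 addr0 lecR ltW.
have gE : \forall z \near within D x^',
    g z = g x + (g z - g x) / (z - x)%:C * (z - x)%:C.
  rewrite /prop_near1 /nbhs /= /within/=; near=> z => Dz /=.
  have zx : (z - x)%:C != 0.
    by rewrite fmorph_eq0 subr_eq0; near: z; exact: nbhs_dnbhs_neq.
  by rewrite divfK// addrC subrK.
have H : ((f z - f x) / (z - x)%:C * g z +
    f x * ((g z - g x) / (z - x)%:C) : R[i]^o)
    @[z --> within D x^'] --> (l * g x + f x * m : R[i]^o).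
  exact: (cvg_product_increment (K := R[i]) (f0 := f x) fl gm idx gE).
rewrite /has_deriv_within.
apply: cvg_trans H; apply: near_eq_cvg; apply: nearW => z /=.
ring.
Unshelve. all: by end_near. Qed.

(** * Increments estimated from derivatives *)

(** Mean value inequality by real induction; the extra 1 in the slope absorbs the error of the
    linear approximation at each point. *)
Lemma has_deriv_within_lipschitz (R : realType) (a b M : R) (f df : R -> R[i]) :
  (forall x, x \in `[a, b] -> has_deriv_within `[a, b] f x (df x)) ->
  (forall x, a <= x <= b -> normc (df x) <= M) ->
  forall u v, a <= u -> u <= v -> v <= b -> normc (f v - f u) <= (M + 1) * (v - u).
Proof.
move=> fd dfM u v au uv vb.
apply: (@interval_induction R u v
  (fun t => normc (f t - f u) <= (M + 1) * (t - u))) => //.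
  by rewrite !subrr normc0 mulr0.
move=> x /andP[ux xv].
have xab : x \in `[a, b] by rewrite in_itv /= (le_trans au) ?(le_trans xv).
have [d d0 Hd] := has_deriv_withinP (fd _ xab) ltr01.
have dx : normc (df x) <= M by apply: dfM; rewrite in_itv /= in xab.
have Hz z : a <= z <= b -> `|z - x| < d ->
    normc (f z - f x) <= (M + 1) * `|z - x|.
  move=> zab zx; rewrite -[f z - f x](subrK (df x * (z - x)%:C)).
  apply: (le_trans (le_normcD _ _)); rewrite normcM normc_real.
  rewrite mulrDl addrC lerD// ?ler_wpM2r//.
  by apply: Hd => //=; rewrite in_itv.
exists d => // t w /andP[ut tx] /andP[xw wv] xt wx IH.
have Hw : normc (f w - f x) <= (M + 1) * (w - x).
  by have := Hz w; rewrite ger0_norm ?subr_ge0//; apply; lra.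
have Ht : normc (f t - f x) <= (M + 1) * (x - t).
  by have := Hz t; rewrite distrC ger0_norm ?subr_ge0//; apply; lra.
(* The approximation is centred at [x], so the path from [t] to [w] goes through [x]; the three
   lengths add up to [w - u]. *)
have -> : f w - f u = (f w - f x) + (f t - f u) - (f t - f x) by ring.
have := le_normcD ((f w - f x) + (f t - f u)) (- (f t - f x)).
have := le_normcD (f w - f x) (f t - f u).
by rewrite normcN; lra.
Qed.

(* Near a point outside the exceptional null set the increments of [f] over
   short intervals are small relative to the length; the remaining points are
   covered by an open set of small measure, where absolute continuity bounds
   the total increment. *)
Lemma abs_continuous_deriv0 (R : realType) (a b : R) (f : R -> R[i]) :
  a < b -> abs_continuous a b f ->
  {ae @lebesgue_measure R, forall x, x \in `]a, b[ ->
     has_deriv_within `[a, b] f x 0} ->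
  f b = f a.
Proof.
move=> ab /abs_continuousP fac [N [mN N0 subN]].
apply/eqP; rewrite -subr_eq0; apply/eqP/eq0_normc/eqP.
rewrite eq_le normc_ge0 andbT; apply/ler_addgt0Pl => e e0; rewrite addr0.
have e2 : 0 < e / 2 by lra.
have [d d0 Hd] := fac _ e2.
(* Half of [e] is spread evenly over [[a, b]]; the other half is left for the intervals covering the
   exceptional set. *)
pose e1 := e / 2 / (b - a).
have e10 : 0 < e1 by rewrite divr_gt0// subr_gt0.
(* The derivative is given on the open interval only, so the endpoints are treated as
   exceptional. *)
pose N' : set R := N `|` [set a; b].
have mab : measurable [set a; b] by apply: measurableU; exact: measurable_set1.
have mN' : measurable N' by apply: measurableU.
have N'0 : lebesgue_measure N' = 0%E.
  apply/eqP; rewrite eq_le measure_ge0 andbT.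
  apply: (le_trans (measureU2 _ _ _)) => //.
  rewrite [X in (X + _)%E]N0 add0e.
  by rewrite [leLHS](countable_lebesgue_measure0 (finite_set_countable _)).
have [|U [oU N'U UN']] := @lebesgue_regularity_outer R N' d mN' _ d0.
  by rewrite [X in (X < _)%E]N'0.
have mU : measurable U by exact: measurable_realfun.open_measurable.
have Ud : (lebesgue_measure U < d%:E)%E.
  apply: le_lt_trans UN'; rewrite -[U in X in (X <= _)%E](setDUK N'U).
  apply: (le_trans (measureU2 _ _ _)) => //; first exact: measurableD.
  by rewrite [X in (X + _)%E]N'0 add0e.
(* Invariant: up to [t], the increment of [f] costs [e1] per unit length, apart from finitely many
   intervals inside [U]. These are listed from left to right, so a new one can be appended without
   losing disjointness. *)
pose P t := exists n (u v : nat -> R), [/\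
  forall k, (k < n)%N -> a <= u k <= v k /\ v k <= t,
  forall k, (k < n)%N -> `]u k, v k[ `<=` U,
  forall i j, (i < j < n)%N -> v i <= u j &
  normc (f t - f a) <=
    e1 * (t - a) + \sum_(k < n) normc (f (v k) - f (u k))].
have : P b.
  apply: (@interval_induction R a b) => //; first exact: ltW.
    exists 0%N, (fun=> 0), (fun=> 0); split => //.
    by rewrite big_ord0 !subrr normc0 mulr0 addr0.
  move=> x /andP[ax xb]; have [xN|xN] := pselect (N' x).
    have [r [r0 rU]] : exists r : R, 0 < r /\ `]x - r, x + r[ `<=` U.
      apply: (@filter_ex _ (0 : R)^'+); near=> r; split; first by [].
      by near: r; apply: open_itvoo_subset => //; exact: N'U.
    (* Near an exceptional point the step from [t] to [w] stays in [U] and becomes the interval of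
       index [n]. *)
    exists r => // t w /andP[at_ tx] /andP[xw wb] xt wx [n [u [v [uv uvU vu ft]]]].
    exists n.+1, (fun k => if (k < n)%N then u k else t),
      (fun k => if (k < n)%N then v k else w); split.
    - move=> k kn; case: ifPn => [/uv[-> vt]|_]; last by split; lra.
      by split => //; lra.
    - move=> k kn; case: ifPn => [/uvU //|_].
      apply: subset_trans rU => z /=; rewrite !in_itv /= => /andP[tz zw].
      by apply/andP; split; lra.
    - move=> i j /andP[ij]; rewrite ltnS => jn; rewrite (leq_trans ij jn).
      case: ifPn => jn'; first by apply: vu; rewrite ij jn'.
      by have [] := uv i (leq_trans ij jn).
    - rewrite big_ord_recr /= ltnn.
      under eq_bigr => k _ do rewrite ltn_ord.
      have e1t : e1 * (t - a) <= e1 * (w - a) by rewrite ler_pM2l//; lra.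
      have -> : f w - f a = (f t - f a) + (f w - f t) by ring.
      have := le_normcD (f t - f a) (f w - f t); lra.
  have xab : x \in `]a, b[.
    rewrite in_itv /= !lt_neqAle ax xb !andbT.
    by apply/andP; split; apply/eqP => E; apply: xN; right; rewrite /= E; [left|right].
  have fx : has_deriv_within `[a, b] f x 0.
    by apply: contrapT => fx; apply: xN; left; apply: subN => /= /(_ xab).
  (* Elsewhere the zero derivative pays for the step at rate [e1], and the list of intervals is
     kept. *)
  have [r r0 Hr] := has_deriv_withinP fx e10.
  exists r => // t w /andP[at_ tx] /andP[xw wb] xt wx [n [u [v [uv uvU vu ft]]]].
  exists n, u, v; split => //.
    by move=> k /uv[-> vt]; split => //; lra.
  have Hz z : a <= z <= b -> `|z - x| < r -> normc (f z - f x) <= e1 * `|z - x|.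
    move=> zab zx; by have := Hr z; rewrite mul0r subr0; apply.
  have Hw : normc (f w - f x) <= e1 * (w - x).
    by have := Hz w; rewrite ger0_norm ?subr_ge0//; apply; lra.
  have Ht : normc (f t - f x) <= e1 * (x - t).
    by have := Hz t; rewrite distrC ger0_norm ?subr_ge0//; apply; lra.
  have -> : f w - f a = (f w - f x) + (f t - f a) - (f t - f x) by ring.
  have := le_normcD ((f w - f x) + (f t - f a)) (- (f t - f x)).
  have := le_normcD (f w - f x) (f t - f a).
  by rewrite normcN; lra.
move=> [n [u [v [uv uvU vu fba]]]].
apply: (le_trans fba); rewrite /e1 divfK ?subr_eq0 ?gt_eqF// [leRHS]splitr lerD2l.
have uvd : trivIset [set: 'I_n] (fun k : 'I_n => `]u k, v k[%classic).
  apply/trivIsetP => i j _ _ ij; wlog: i j ij / (i < j)%N.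
    move=> H; have : (i != j :> nat) by [].
    by rewrite neq_ltn => /orP[/H|/H]; [apply|rewrite setIC; apply; rewrite eq_sym].
  move=> {}ij; have := vu i j; rewrite ij ltn_ord => /(_ isT) viuj.
  rewrite -subset0 => z /=; rewrite !in_itv /= => -[/andP[_ zv] /andP[uz _]].
  by move: (lt_trans uz zv); rewrite ltNge viuj.
apply/ltW/(Hd n (fun k => u k) (fun k => v k)) => //; first by move=> k; exact: uv.
(* The total length is at most the measure of [U], hence below [d]. Padding with empty sets gives a
   sequence to which additivity of the measure applies. *)
pose I k := if (k < n)%N then `]u k, v k[%classic else set0.
have tI : trivIset [set: nat] I.
  apply/trivIsetP => i j _ _ ij; rewrite /I.
  case: ifPn => iltn; case: ifPn => jltn; rewrite ?setI0 ?set0I//.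
  by move/trivIsetP: uvd => /(_ (Ordinal iltn) (Ordinal jltn)); apply.
have mI k : measurable (I k) by rewrite /I; case: ifP.
rewrite -lte_fin; apply: le_lt_trans Ud.
have -> : (\sum_(k < n) (v k - u k))%:E =
    (\sum_(k < n) lebesgue_measure (I k))%E.
  rewrite -sumEFin; apply: eq_bigr => k _; rewrite /I ltn_ord.
  rewrite lebesgue_measure_itv /= lte_fin.
  have [//|] := ltP (u k) (v k); have [/andP[_]] := uv k (ltn_ord k).
  by move=> *; congr (_%:E); lra.
rewrite -measure_bigsetU//; apply: le_measure; rewrite ?inE//.
  by apply: bigsetU_measurable => k _; exact: mI.
apply: subset_trans (@bigsetU_bigcup _ _ _) _.
by move=> z [k _]; rewrite /I; case: ifPn => // kn; exact: uvU kn z.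
Unshelve. all: by end_near. Qed.

(** * The Wronskian *)

Lemma wronskian_const (R : realType) (a : R) (q : R -> R) (rho : R[i])
    (C dC S dS : R -> R[i]) :
  0 < a -> is_solution a q rho C dC -> is_solution a q rho S dS ->
  C a * dS a - dC a * S a = C 0 * dS 0 - dC 0 * S 0.
Proof.
move=> a0 [Cd dCac Cq] [Sd dSac Sq].
(* The derivatives, being absolutely continuous, are bounded; hence the solutions are Lipschitz. *)
have ac f df : (forall x, x \in `[0, a] -> has_deriv_within `[0, a] f x (df x)) ->
    abs_continuous 0 a df -> abs_continuous 0 a f.
  move=> fd /abs_continuous_bounded[M _ dfM].
  exact: lipschitz_abs_continuous (has_deriv_within_lipschitz fd dfM).
apply: (@abs_continuous_deriv0 R 0 a (fun x => C x * dS x - dC x * S x)) => //.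
  apply: abs_continuousB; apply: abs_continuousM => //.
  - exact: ac Cd dCac.
  - exact: ac Sd dSac.
apply: (@filterS2 _ _ (ae_filter_ringOfSetsType (@lebesgue_measure R)))
  Cq Sq => x HC HS x0a.
have [ddC dCd EC] := HC x0a; have [ddS dSd ES] := HS x0a.
have x0a' : x \in `[0, a] by apply: subset_itv_oo_cc.
(* The products of first derivatives cancel, and both second derivatives are the same factor
   [q - rho ^+ 2] times the solution. *)
have -> : (0 : R[i]) =
    dC x * dS x + C x * ddS - (ddC * S x + dC x * dS x).
  have -> : ddC = (q x)%:C * C x - rho ^+ 2 * C x by rewrite -EC; ring.
  have -> : ddS = (q x)%:C * S x - rho ^+ 2 * S x by rewrite -ES; ring.
  ring.
exact: has_deriv_withinB (has_deriv_withinM (Cd x x0a') dSd)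
  (has_deriv_withinM dCd (Sd x x0a')).
Qed.

Lemma fundamental_pair_wronskian (R : realType) (a : R) (q : R -> R) (rho : R[i])
    (C dC S dS : R -> R[i]) :
  0 < a -> fundamental_pair a q rho C dC S dS ->
  C a * dS a - dC a * S a = 1.
Proof.
move=> a0 [hC hS [C0 dC0] [S0 dS0]].
by rewrite (wronskian_const a0 hC hS) C0 dC0 S0 dS0; ring.
Qed.

(** * Complex exponentials *)

Lemma expiD (R : realType) (s t : R) : expi (s + t) = expi s * expi t.
Proof. by rewrite /expi cosD sinD; simpc; congr (_ +i* _); ring. Qed.

Lemma expi_neq0 (R : realType) (t : R) : expi t != 0.
Proof.
have : expi t * expi (- t) = 1 by rewrite -expiD subrr /expi cos0 sin0.
by apply: contra_eq_neq => ->; rewrite mul0r eq_sym oner_eq0.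
Qed.

Lemma expiN (R : realType) (t : R) : expi (- t) = (expi t)^-1.
Proof.
apply: (mulfI (expi_neq0 t)).
by rewrite divff ?expi_neq0// -expiD subrr /expi cos0 sin0.
Qed.

Lemma expi_cos (R : realType) (t : R) :
  2 * (cos t)%:C = expi t + (expi t)^-1.
Proof.
rewrite -expiN /expi cosN sinN mulrDl mul1r; simpc.
by congr (_ +i* _); ring.
Qed.

(** * Evaluation of the determinant *)

(** Cofactor expansion along the first row, on lists so that it reduces by computation to an
    expression that [ring] can handle. *)
Fixpoint laplace (K : comNzRingType) (n : nat) (rows : seq (seq K)) : K :=
  if n is m.+1 then
    foldr (fun j d => nth 0 (head [::] rows) j *
      ((-1) ^+ j * laplace m [seq take j r ++ drop j.+1 r | r <- behead rows])
      + d) 0 (iota 0 n)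
  else 1.

Lemma det_laplace (K : comNzRingType) (n : nat) (rows : seq (seq K)) :
  size rows = n -> all (fun r => size r == n) rows ->
  \det (\matrix_(i < n, j < n) nth 0 (nth [::] rows i) j) = laplace n rows.
Proof.
elim: n rows => [|n IHn] [|r rows] //; first by rewrite det_mx00.
move=> [sr] /andP[_ rowsn].
rewrite (expand_det_row _ ord0) /laplace -/laplace.
transitivity (\sum_(j <- iota 0 n.+1) (nth 0 r j *
  ((-1) ^+ j * laplace n [seq take j r0 ++ drop j.+1 r0 | r0 <- rows])));
  last by rewrite unlock /reducebig.
rewrite -[iota 0 n.+1]/(index_iota 0 n.+1) big_mkord; apply: eq_bigr => j _.
rewrite mxE /cofactor add0n -IHn ?size_map//; last first.
  rewrite all_map; apply: sub_all rowsn => s /= /eqP ss.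
  by rewrite size_cat size_take size_drop ss ltn_ord subSS subnKC// -ltnS.
congr (_ * (_ * \det _)); apply/matrixP => i k; rewrite !mxE /=.
rewrite (nth_map [::]) ?sr// nth_cat size_take.
have /(all_nthP [::]) /(_ i) := rowsn; rewrite sr => /(_ (ltn_ord i)) /eqP ->.
(* Columns before the deleted one keep their index, later ones shift by one, as [take] and [drop]
   do. *)
rewrite ltn_ord /bump leqNgt; case: ltnP => kj.
  by rewrite nth_take.
by rewrite nth_drop addSn subnKC.
Qed.

(** In the application [u], [s], [w] are [C], [S], [dC] times the phase of the edge, and [v] is [dS]
    times that phase, minus 1. *)
Lemma det_char_system (K : comNzRingType)
    (u1 u2 u3 s1 s2 s3 w1 w2 w3 v1 v2 v3 : K) :
  \det (\matrix_(i < 6, j < 6) nth 0 (nth [::]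
    [:: [:: -1; 1; 0; 0; 0; 0];
        [:: -1; 0; 1; 0; 0; 0];
        [:: -1 + u1; 0; 0; s1; 0; 0];
        [:: -1; u2; 0; 0; s2; 0];
        [:: -1; 0; u3; 0; 0; s3];
        [:: w1; w2; w3; v1; v2; v3]] i) j) =
  (u1 - 1) * v1 * s2 * s3 + (u2 - 1) * v2 * s1 * s3 + (u3 - 1) * v3 * s1 * s2
  - (w1 + w2 + w3) * s1 * s2 * s3.
Proof. by rewrite det_laplace// /laplace /=; ring. Qed.

(** * The characteristic function *)

Theorem theorem2p1 (R : realType) (a : R) (ha : 0 < a)
    (q1 q2 q3 : R -> R) (hq1 : L2_on a q1) (hq2 : L2_on a q2) (hq3 : L2_on a q3)
    (rho : R[i])
    (C1 C2 C3 dC1 dC2 dC3 S1 S2 S3 dS1 dS2 dS3 : R -> R[i])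
    (h1 : fundamental_pair a q1 rho C1 dC1 S1 dS1)
    (h2 : fundamental_pair a q2 rho C2 dC2 S2 dS2)
    (h3 : fundamental_pair a q3 rho C3 dC3 S3 dS3)
    (theta1 theta2 : R)
    (htheta1 : - pi <= theta1 <= pi) (htheta2 : - pi <= theta2 <= pi) :
  char_function a theta1 theta2 C1 C2 C3 dC1 dC2 dC3 S1 S2 S3 dS1 dS2 dS3 =
  - expi (- (2 * theta2)) *
    ((dS1 a * S2 a * S3 a + S1 a * dS2 a * S3 a + S1 a * S2 a * dS3 a)
     + (C1 a * S2 a * S3 a + C2 a * S3 a * S1 a + C3 a * S1 a * S2 a)
     - 2 * S1 a * S2 a * (cos (theta2 - theta1))%:C
     - 2 * S2 a * S3 a * (cos theta1)%:C
     - 2 * S1 a * S3 a * (cos theta2)%:C).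
Proof.
rewrite /char_function /char_matrix det_char_system.
have W1 := fundamental_pair_wronskian ha h1.
have W2 := fundamental_pair_wronskian ha h2.
have W3 := fundamental_pair_wronskian ha h3.
have cosE (t : R) (x y : R[i]) :
    2 * x * y * (cos t)%:C = (expi t + (expi t)^-1) * x * y.
  by rewrite -expi_cos; ring.
rewrite !cosE expiD !expiN [2 * theta2]mulr_natl mulr2n expiD.
move: (expi_neq0 theta1) (expi_neq0 theta2).
move: (expi theta1) (expi theta2) => x y x0 y0.
apply/eqP; rewrite -subr_eq0; apply/eqP.
(* Now the edge phases are [x^-1], [y^-1] and [x / y], with product [y ^- 2]. The two sides differ
   by the Wronskian defects of the edges, each weighted by its own phase, this product, and the [S]
   of the two other edges. *)
transitivity (x^-1 * y ^- 2 * S2 a * S3 a * (C1 a * dS1 a - dC1 a * S1 a - 1)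
  + y ^- 3 * S1 a * S3 a * (C2 a * dS2 a - dC2 a * S2 a - 1)
  + x * y ^- 3 * S1 a * S2 a * (C3 a * dS3 a - dC3 a * S3 a - 1)).
  by field; rewrite x0 y0.
by rewrite W1 W2 W3 subrr !mulr0 !addr0.
Qed.
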